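(* Let $D$ be a digraph of order $n \geq 4$. If $d^{+}_{D}(x) + d^{-}_{D}(y) \geq n+2$ for every ordered pair of distinct vertices $x,y$ of $D$ with $xy \notin A(D)$, then $D$ is paired many-to-many $2$-coverable. Moreover, the bound for $d^{+}_{D}(x)+d^{-}_{D}(y)$ is sharp, in the following sense: for every $n \geq 9$ there exists a digraph $D$ on $n$ vertices with $d^{+}_{D}(x)+d^{-}_{D}(y) = n+1$ for every ordered pair of distinct vertices $x,y$ with $xy\notin A(D)$, which is not paired many-to-many $2$-coverable.
   Context: All digraphs $D=(V(D),A(D))$ are finite, with no parallel arcs and no loops (pairs of oppositely directed arcs are allowed). The order of $D$ is $|V(D)|$. $xy\in A(D)$ denotes the arc from $x$ to $y$; $d^{+}_D(v)$ and $d^{-}_D(v)$ are the out-degree and in-degree of $v$. A path always means a directed path; an $x$-$y$ path is a path from $x$ to $y$. Let $S=\{s_1,\dots,s_k\}$ (source set) and $T=\{t_1,\dots,t_k\}$ (sink set) be two disjoint $k$-element subsets of $V(D)$. A paired many-to-many $k$-DDPC ($k$-disjoint directed path cover) for $S$ and $T$ is a set of $k$ pairwise vertex-disjoint paths $\{P_1,\dots,P_k\}$ of $D$ with $\bigcup_{i=1}^{k} V(P_i)=V(D)$ such that $P_i$ is an $s_i$-$t_i$ path for each $i\in\{1,\dots,k\}$. A digraph $D$ of order $n\geq 2k$ is paired many-to-many $k$-coverable if it has a paired many-to-many $k$-DDPC for every pair of disjoint source set $S=\{s_1,\dots,s_k\}$ and sink set $T=\{t_1,\dots,t_k\}$ (with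 any indexing of their elements). *)

(* Defs.v *)
From mathcomp Require Import all_boot.
Set Implicit Arguments.
Unset Strict Implicit.
Unset Printing Implicit Defensive.

(* A digraph is a finite vertex type V together with an arc relation e : rel V
   (so there are no parallel arcs); looplessness is the separate hypothesis
   [irreflexive e]. *)

Definition outdeg (V : finType) (e : rel V) (v : V) : nat := #|[set w | e v w]|.
Definition indeg (V : finType) (e : rel V) (v : V) : nat := #|[set w | e w v]|.

(* p lists all the vertices of the path, both ends included; the one-vertex
   path [:: x] is an x-x path. *)
Definition dipath (V : finType) (e : rel V) (x y : V) (p : seq V) : bool :=
  if p is z :: q then [&& z == x, path e z q, last z q == y & uniq (z :: q)]
  else false.

Definition paired_ddpc (V : finType) (e : rel V) (k : nat)
    (s t : 'I_k -> V) (P : 'I_k -> seq V) : Prop :=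
  [/\ forall i, dipath e (s i) (t i) (P i),
      forall i j, i != j -> [disjoint P i & P j]
    & forall v, exists i, v \in P i].

(* The source and sink sets come with their indexing: an indexed k-element
   subset is an injective map from 'I_k. *)
Definition paired_coverable (k : nat) (V : finType) (e : rel V) : Prop :=
  2 * k <= #|V| /\
  forall s t : 'I_k -> V,
    injective s -> injective t -> (forall i j, s i != t j) ->
    exists P : 'I_k -> seq V, paired_ddpc e s t P.

(* Main.v *)
Require Import Defs.
From mathcomp Require Import all_boot zify.
Set Implicit Arguments.
Unset Strict Implicit.
Unset Printing Implicit Defensive.

(** The covering statement is a Hamiltonian cycle problem in disguise.  Given
    the pairs (s1, t1) and (s2, t2), merge t1 with s2 and t2 with s1: each
    merged vertex keeps the in-arcs of its sink and the out-arcs of its source.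
    Cutting a Hamiltonian cycle of the merged digraph at its two merged
    vertices leaves exactly an s1-t1 path and an s2-t2 path that together
    cover everything ([two_paths_of_cycle]).  Merging removes two vertices, and
    each vertex loses at most two out-neighbours and two in-neighbours, so
    the hypothesis with n + 2 becomes d^+(x) + d^-(y) >= n - 2 on n - 2
    vertices: precisely the condition of Woodall's theorem
    ([woodall_hamiltonian]).

    Woodall's theorem is proved by looking at a longest cycle C, supposed not
    spanning, and at its complement R.  No path through R can replace an arc of
    C, so for a path of R from u to w at most |C| arcs in all go from C to u and
    from w to C.
    Compared with the degree condition this leaves so many arcs inside R that R
    is strongly connected ([rest_connected]).  Now cut C into a path P and a
    remainder Q, where P starts at a vertex entered from R, ends at a vertex
    with an arc to R, and no vertex of Q has an arc from or to R
    ([cyclic_gap]).  Q is nonempty, since otherwise P closed through R would be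
    longer than C.  A vertex u of R sees only P, and at most |P| + 1 arcs of it;
    the degree condition between u and the first vertex a and last vertex b of
    Q then forces more than |P| + 1 arcs from P to a or from b to P.  Hence all
    of Q fits between two consecutive vertices of P, and P so enlarged closes
    up through R to a cycle longer than C.

    For sharpness, read the reduction backwards.  In a complete digraph with one
    extra vertex attached to it through a single vertex z, no Hamiltonian cycle
    exists and the degree sums miss the bound of Woodall's theorem by one.
    Undoing the merge of two vertices of the complete part gives [sharp_arc]:
    its special vertex b can only be reached from z or from a sink, and can only
    be left to z or to a source, so a covering path would need z both just
    before and just after b. *)

(** * Consecutive entries and counting *)

(** The pigeonhole behind every insertion argument: if consecutive y, z never
    satisfy f y and g z together, each of the [size p] adjacent positions
    contributes at most one, and only f at the end and g at the start are left
    over. *)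
Lemma count_consecutive (T : Type) (f g : pred T) x p :
  size p + f (last x p) + g x < count f (x :: p) + count g (x :: p) ->
  exists s1 y z s2, [/\ x :: p = s1 ++ y :: z :: s2, f y & g z].
Proof.
elim: p x => [|y p IH] x; first by rewrite /=; lia.
have [/andP[fx gy] _|nfg] := boolP (f x && g y); first by exists [::], x, y, p.
rewrite [last x _]/= => lt_count.
have [|s1 [y' [z [s2 [-> fy' gz]]]]] := IH y.
  by move: nfg lt_count => /=; case: (f x); case: (g y) => //=; lia.
by exists (x :: s1), y', z, s2.
Qed.

Lemma count_consecutive_slack (T : Type) (f g : pred T) x p :
  (size p).+2 < count f (x :: p) + count g (x :: p) ->
  exists s1 y z s2, [/\ x :: p = s1 ++ y :: z :: s2, f y & g z].
Proof.
move=> lt_count; apply: count_consecutive; apply: leq_ltn_trans lt_count.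
by case: (f _); case: (g _); rewrite /=; lia.
Qed.

(** On a cycle the last and first entries are consecutive too, so the slack of
    the linear version disappears. *)
Lemma count_cycle_consecutive (T : Type) (f g : pred T) c :
  size c < count f c + count g c ->
  exists i x p, [/\ rot i c = x :: p, f (last x p) & g x].
Proof.
case: c => [//|x p] lt_count.
have [/andP[fl gx]|nfg] := boolP (f (last x p) && g x).
  by exists 0, x, p; rewrite rot0.
have [|s1 [y [z [s2 [-> fy gz]]]]] := @count_consecutive T f g x p.
  by move: nfg lt_count => /=; case: (f (last x p)); case: (g x) => //=; lia.
exists (size (rcons s1 y)), z, (s2 ++ rcons s1 y).
by rewrite -cat_rcons rot_size_cat last_cat last_rcons.
Qed.

Lemma split_first (T : Type) (a : pred T) s : has a s ->
  exists s1 y s2, [/\ s = s1 ++ y :: s2, a y & ~~ has a s1].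
Proof. by case/split_find => y s1 s2 ay na; exists s1, y, s2; rewrite cat_rcons. Qed.

Lemma split_last (T : Type) (a : pred T) s : has a s ->
  exists s1 y s2, [/\ s = s1 ++ y :: s2, a y & ~~ has a s2].
Proof.
rewrite -has_rev => /split_first[s1 [y [s2 [def_s ay na]]]].
exists (rev s2), y, (rev s1); split=> //; last by rewrite has_rev.
by rewrite -[s]revK def_s rev_cat rev_cons cat_rcons.
Qed.

(** The witness is a remainder [q] free of both properties: look from an
    [a]-vertex for the next [b]-vertex, then go back from there to the last
    [a]-vertex. *)
Lemma cyclic_gap (T : Type) (a b : pred T) (c : seq T) :
  has a c -> has b c ->
  exists i x p q, [/\ rot i c = (x :: p) ++ q, b x, a (last x p)
                    & ~~ has a q /\ ~~ has b q].
Proof.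
case/split_last=> c1 [y [c2 [def_c ay _]]].
set j := size (rcons c1 y).
have rot_c : rot j c = c2 ++ rcons c1 y by rewrite def_c -cat_rcons rot_size_cat.
rewrite -(has_rot j) => /split_first[s1 [x [s2 [def_rot bx nb]]]].
have last_y : last y (rot j c) = y by rewrite rot_c last_cat last_rcons.
have [/split_last[s3 [y' [q [def_s1 ay' naq]]]]|na] := boolP (has a s1); last first.
  exists (rot_add c j (size s1)), x, s2, s1; split=> //.
    by rewrite -rot_rot_add def_rot rot_size_cat.
  by move: last_y; rewrite def_rot last_cat /= => ->.
exists (rot_add c j (size s1)), x, (s2 ++ rcons s3 y'), q; split=> //.
- by rewrite -rot_rot_add def_rot rot_size_cat def_s1 -cat_rcons /= catA.
- by rewrite last_cat last_rcons.
- by move: nb; rewrite def_s1 has_cat /= !negb_or => /and3P[].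
Qed.

(** * Degrees as counts *)

Section Degrees.
Variables (V : finType) (e : rel V).
Hypothesis e_irr : irreflexive e.

Lemma outdeg_count x : outdeg e x = count (e x) (enum V).
Proof. by rewrite /outdeg cardsE cardE size_filter enumT. Qed.

Lemma indeg_count x : indeg e x = count (e^~ x) (enum V).
Proof. by rewrite /indeg cardsE cardE size_filter enumT. Qed.

Lemma count_out_lt x s : x \in s -> count (e x) s < size s.
Proof.
move=> xs; rewrite ltn_neqAle count_size andbT -all_count.
by apply/allP => /(_ x xs); rewrite e_irr.
Qed.

Lemma count_in_lt x s : x \in s -> count (e^~ x) s < size s.
Proof.
move=> xs; rewrite ltn_neqAle count_size andbT -all_count.
by apply/allP => /(_ x xs); rewrite /= e_irr.
Qed.

(** Neither [x] nor [y] lies in the union of the two neighbourhoods, so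
    as many neighbours as entries of [s] force an overlap. *)
Lemma common_neighbour x y s : x \in s -> ~~ e x y ->
  size s <= count (e x) s + count (e^~ y) s ->
  exists z, [/\ z \in s, e x z & e z y].
Proof.
move=> xs nexy; rewrite -count_predUI => le_s.
have ltU : count (predU (e x) (e^~ y)) s < size s.
  rewrite ltn_neqAle count_size andbT -all_count.
  by apply/allP => /(_ x xs); rewrite /= e_irr (negPf nexy).
have : has (predI (e x) (e^~ y)) s by rewrite has_count; lia.
by case/hasP => z zs /andP[exz ezy]; exists z.
Qed.

End Degrees.

(** * Hamiltonian cycles under Woodall's condition *)

Section Woodall.
Variables (V : finType) (e : rel V).
Hypothesis e_irr : irreflexive e.
Hypothesis deg_e : forall x y, x != y -> ~~ e x y ->
  #|V| <= outdeg e x + indeg e y.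

Lemma two_step x y : x != y -> ~~ e x y -> exists z, e x z /\ e z y.
Proof.
move=> nxy nexy; have := deg_e nxy nexy.
rewrite outdeg_count indeg_count cardE.
case/(common_neighbour e_irr (mem_enum _ x) nexy) => z [_ exz ezy].
by exists z.
Qed.

Section LongestCycle.
Variable c : seq V.
Hypotheses (uniq_c : uniq c) (cycle_c : cycle e c).
Hypothesis max_c : forall c', uniq c' -> cycle e c' -> size c' <= size c.

Let R := [seq x <- enum V | x \notin c].
(* Only the target of an arc is required to avoid [c]; the lemmas below take
   starting points outside [c]. *)
Let eR := [rel x y | e x y && (y \notin c)].

Let mem_R x : (x \in R) = (x \notin c).
Proof. by rewrite mem_filter mem_enum andbT. Qed.

Lemma perm_cycle_rest : perm_eq (enum V) (c ++ R).
Proof.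
apply: uniq_perm; first exact: enum_uniq.
  rewrite cat_uniq uniq_c filter_uniq ?enum_uniq // andbT /=.
  by apply/hasPn => x; rewrite mem_R.
by move=> x; rewrite mem_enum mem_cat mem_R orbN.
Qed.

Lemma deg_split x y : x != y -> ~~ e x y ->
  size c + size R <= count (e x) c + count (e x) R
                     + (count (e^~ y) c + count (e^~ y) R).
Proof.
move=> nxy nexy; have := deg_e nxy nexy.
rewrite outdeg_count indeg_count cardE (perm_size perm_cycle_rest) size_cat.
by rewrite !(permP perm_cycle_rest) !count_cat.
Qed.

(** Closing the path [x :: p] through the outside of [c] gives a cycle longer
    than the path; by maximality the path must then miss part of [c]. *)
Lemma detour_size x p u w :
  path e x p -> uniq (x :: p) -> {subset x :: p <= c} ->
  u \notin c -> connect eR u w -> e (last x p) u -> e w x ->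
  size (x :: p) < size c.
Proof.
move=> path_p uniq_p sub_p uR /connectP[q0 path_q0 ->].
case/shortenP: path_q0 => q path_q uniq_q _ e_pu e_qx.
have [path_eq qR] : path e u q /\ all [predC c] q.
  elim: q u {uR uniq_q e_pu e_qx} path_q => //= y q IH u /andP[/andP[-> yR]].
  by rewrite yR => /IH[-> ->].
suff le_c : size ((x :: p) ++ u :: q) <= size c.
  by move: le_c; rewrite size_cat /=; lia.
apply: max_c.
  rewrite cat_uniq uniq_p uniq_q andbT /= negb_or.
  apply/andP; split; first by apply: contra uR; apply: sub_p.
  apply/hasPn => y /(allP qR) /=; apply: contra; exact: sub_p.
by rewrite /= rcons_cat cat_path path_p /= e_pu rcons_path path_eq.
Qed.

Lemma rot_path i x p : rot i c = x :: p ->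
  [/\ path e x p, uniq (x :: p), {subset x :: p <= c} & size (x :: p) = size c].
Proof.
move=> rot_c; split; last by rewrite -rot_c size_rot.
- by move: cycle_c; rewrite -(rot_cycle i) rot_c /= rcons_path => /andP[].
- by rewrite -rot_c rot_uniq.
- by move=> y; rewrite -rot_c mem_rot.
Qed.

Lemma no_full_detour i x p u w : rot i c = x :: p ->
  u \notin c -> connect eR u w -> e (last x p) u -> ~~ e w x.
Proof.
case/rot_path => path_p uniq_p sub_p size_p uR uw e_pu.
apply/negP => e_wx; move: (detour_size path_p uniq_p sub_p uR uw e_pu e_wx).
by rewrite size_p ltnn.
Qed.

Lemma count_detour u w : u \notin c -> connect eR u w ->
  count (e^~ u) c + count (e w) c <= size c.
Proof.
move=> uR uw; rewrite leqNgt; apply/negP.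
case/count_cycle_consecutive => i [x [p [rot_c e_pu e_wx]]].
by move: (no_full_detour rot_c uR uw e_pu); rewrite e_wx.
Qed.

Lemma connect_two_step u w : u \notin c -> w \notin c -> ~~ e u w ->
  size R <= count (e u) R + count (e^~ w) R -> connect eR u w.
Proof.
move=> uR wR neuw le_R; rewrite -mem_R in uR.
have [z [zR euz ezw]] := common_neighbour e_irr uR neuw le_R.
rewrite mem_R in zR.
apply: (@connect_trans _ _ z); apply: connect1 => /=; apply/andP; split=> //.
Qed.

(** A path from u to w outside [c] makes detours impossible, which caps the
    number of arcs between [c] and the pair; if w u is not an arc, the degree
    sum d^+(w) + d^-(u) has to be made up by a common neighbour outside [c]. *)
Lemma rest_connect_sym u w : u \notin c -> w \notin c ->
  connect eR u w -> connect eR w u.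
Proof.
move=> uR wR uw; have [->|nwu] := eqVneq w u; first exact: connect0.
have [ewu|newu] := boolP (e w u); first by apply: connect1; rewrite /= ewu.
apply: connect_two_step => //.
by have := deg_split nwu newu; have := count_detour uR uw; lia.
Qed.

(** If neither vertex reached the other, both nonarcs would count: each
    vertex alone has at most [size c] arcs to and from [c], so of the two
    degree sums one leaves enough for a common neighbour outside [c]. *)
Lemma rest_connected u w : u \notin c -> w \notin c -> connect eR u w.
Proof.
move=> uR wR; apply/negPn/negP => nuw.
have nwu : ~~ connect eR w u by apply: contra nuw; apply: rest_connect_sym.
have neq : u != w by apply: contraNneq nuw => ->; apply: connect0.
have neuw : ~~ e u w by apply: contra nuw => euw; apply: connect1; rewrite /= euw.
have newu : ~~ e w u by apply: contra nwu => ewu; apply: connect1; rewrite /= ewu.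
have := deg_split neq neuw; rewrite eq_sym in neq; have := deg_split neq newu.
have := count_detour uR (connect0 _ u); have := count_detour wR (connect0 _ w).
have [le_uw|lt_uw] := leqP (size R) (count (e u) R + count (e^~ w) R).
  by case/negP: nuw; apply: connect_two_step.
have [le_wu|lt_wu] := leqP (size R) (count (e w) R + count (e^~ u) R).
  by case/negP: nwu; apply: connect_two_step.
lia.
Qed.

Let toR x := has (e x) R.
Let fromR x := has (e^~ x) R.

Lemma toR_exists v u : v \in c -> u \notin c -> has toR c.
Proof.
move=> vc uR; have [evu|nevu] := boolP (e v u).
  by apply/hasP; exists v => //; apply/hasP; exists u; rewrite ?mem_R.
have nvu : v != u by apply: contraNneq uR => <-.
have [z [evz ezu]] := two_step nvu nevu.
have [zc|zR] := boolP (z \in c).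
  by apply/hasP; exists z => //; apply/hasP; exists u; rewrite ?mem_R.
by apply/hasP; exists v => //; apply/hasP; exists z; rewrite ?mem_R.
Qed.

Lemma fromR_exists v u : v \in c -> u \notin c -> has fromR c.
Proof.
move=> vc uR; have [euv|neuv] := boolP (e u v).
  by apply/hasP; exists v => //; apply/hasP; exists u; rewrite ?mem_R.
have nuv : u != v by apply: contraNneq uR => ->.
have [z [euz ezv]] := two_step nuv neuv.
have [zc|zR] := boolP (z \in c).
  by apply/hasP; exists z => //; apply/hasP; exists u; rewrite ?mem_R.
by apply/hasP; exists v => //; apply/hasP; exists z; rewrite ?mem_R.
Qed.

(** The remainder [q] of the cut supplied by [cyclic_gap] can be inserted as a
    block into the path [x :: p]: the vertex [u] outside [c] has no neighbour in
    [q] and few on the path, so both nonarcs between [u] and the ends of [q]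
    put many arcs between the path and these ends. *)
Lemma longest_cycle_spanning v u : v \in c -> u \in c.
Proof.
move=> vc; apply/negPn/negP => uR.
have [i [x [p [q [rot_c fromx top [ntoq nfromq]]]]]] :=
  cyclic_gap (toR_exists vc uR) (fromR_exists vc uR).
have [w1 + e_w1x] := hasP fromx; rewrite mem_R => w1R.
have [u1 + e_pu1] := hasP top; rewrite mem_R => u1R.
have count_c f : count f c = count f (x :: p) + count f q.
  by rewrite -count_cat -rot_c; apply/esym/permP/permEl/perm_rot.
have size_c : size c = size (x :: p) + size q by rewrite -size_cat -rot_c size_rot.
have q_in_c y : y \in q -> y \in c.
  by move=> yq; rewrite -(mem_rot i) rot_c mem_cat yq orbT.
have q_to y : y \in q -> ~~ e y u.
  move=> yq; apply: contra ntoq => eyu; apply/hasP; exists y => //.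
  by apply/hasP; exists u; rewrite ?mem_R.
have q_from y : y \in q -> ~~ e u y.
  move=> yq; apply: contra nfromq => euy; apply/hasP; exists y => //.
  by apply/hasP; exists u; rewrite ?mem_R.
have [uniq_p path_c] : uniq ((x :: p) ++ q) /\ cycle e ((x :: p) ++ q).
  by rewrite -rot_c rot_uniq rot_cycle.
(* If [q] is empty, the whole cycle, cut open before [x], closes up through
   the outside. *)
case: q => [|a q'] in rot_c ntoq nfromq count_c size_c q_in_c q_to q_from uniq_p path_c *.
  rewrite cats0 in rot_c.
  by move: (no_full_detour rot_c u1R (rest_connected u1R w1R) e_pu1); rewrite e_w1x.
set b := last a q'.
have aq : a \in a :: q' by rewrite mem_head.
have bq : b \in a :: q' by apply: mem_last.
have neq y : y \in a :: q' -> y != u.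
  by move=> /q_in_c yc; apply: contraNneq uR => <-.
have count0 s (f : pred V) : (forall y, y \in s -> ~~ f y) -> count f s = 0.
  by move=> nf; apply/eqP; rewrite -leqn0 leqNgt -has_count; apply/hasPn.
have in_u : count (e^~ u) (a :: q') = 0 by apply: count0.
have out_u : count (e u) (a :: q') = 0 by apply: count0.
have noR y : y \in a :: q' -> count (e y) R = 0 /\ count (e^~ y) R = 0.
  move=> yq; split; apply: count0 => z; rewrite mem_R => zR; apply/negP => ez.
    by case/hasP: ntoq; exists y => //; apply/hasP; exists z; rewrite ?mem_R.
  by case/hasP: nfromq; exists y => //; apply/hasP; exists z; rewrite ?mem_R.
have [outbR _] := noR b bq; have [_ inaR] := noR a aq.
have uRR : u \in R by rewrite mem_R.
have lt_in := count_in_lt e_irr uRR; have lt_out := count_out_lt e_irr uRR.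
have deg_b := deg_split (neq b bq) (q_to b bq).
have neq_ua : u != a by rewrite eq_sym neq.
have deg_a := deg_split neq_ua (q_from a aq).
have lt_b := count_out_lt e_irr bq; have lt_a := count_in_lt e_irr aq.
(* Consecutive y, z on the path with y u and u z arcs would let [u] itself be
   inserted into the cycle. *)
have le_u : count (e^~ u) (x :: p) + count (e u) (x :: p) <= (size p).+2.
  rewrite leqNgt; apply/negP => lt_u.
  have [s1 [y [z [s2 [def_p eyu euz]]]]] := count_consecutive_slack lt_u.
  have rot_c' : rot (rot_add c i (size (rcons s1 y))) c
                = z :: (s2 ++ (a :: q') ++ rcons s1 y).
    by rewrite -rot_rot_add rot_c def_p -(cat_rcons y) -catA rot_size_cat -catA.
  move: (no_full_detour rot_c' uR (connect0 _ u)).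
  by rewrite !last_cat last_rcons euz => /(_ eyu).
(* Add the degree sums of (b, u) and (u, a); of the arcs into [a]
   and of those out of [b], at most [size q'] each stay inside [q]. *)
have lt_ab : (size p).+2 < count (e^~ a) (x :: p) + count (e b) (x :: p).
  rewrite !count_c in_u out_u outbR inaR size_c in deg_a deg_b.
  have size_p : size (x :: p) = (size p).+1 by [].
  move: lt_in lt_out deg_a deg_b lt_a lt_b le_u size_p; clear.
  move: (size R) (count (e^~ u) R) (count (e u) R) => r r1 r2.
  move: (count (e^~ u) (x :: p)) (count (e u) (x :: p)) => pu1 pu2.
  move: (count (e^~ a) (x :: p)) (count (e b) (x :: p)) => pa pb.
  move: (count (e^~ a) (a :: q')) (count (e b) (a :: q')) => qa qb.
  by move: (size (a :: q')) (size (x :: p)) => q1 q2; lia.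
have [s1 [y [z [s2 [def_p eya ebz]]]]] := count_consecutive_slack lt_ab.
have [p' [path_p' last_p' perm_p']] : exists p',
    [/\ path e x p', last x p' = last x p & perm_eq (x :: p') ((x :: p) ++ a :: q')].
  move: path_c; rewrite /= rcons_path cat_path /= => /andP[/and3P[path_p _ path_q] _].
  case: s1 def_p => [|x1 s1] [? def_p]; subst y || subst x1; subst p.
    exists (a :: q' ++ z :: s2); move: path_p; rewrite /= => /andP[_ path_s2]; split.
    - by rewrite eya cat_path path_q /= ebz.
    - by rewrite last_cat.
    - by rewrite perm_cons (perm_catC (a :: q') (z :: s2)).
  exists (s1 ++ y :: (a :: q') ++ z :: s2).
  move: path_p; rewrite !cat_path /= => /and4P[-> -> _ path_s2]; split.
  - by rewrite eya cat_path path_q /= ebz.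
  - by rewrite !last_cat /= last_cat.
  - rewrite perm_cons -catA perm_cat2l /= perm_cons.
    by rewrite (perm_catC (a :: q') (z :: s2)).
have /detour_size : path e x p' by [].
move=> /(_ u1 w1); rewrite (perm_uniq perm_p') uniq_p last_p' (perm_size perm_p').
rewrite size_cat -size_c ltnn => /(_ isT) false_detour.
apply: notF; apply: false_detour => //; last exact: rest_connected.
by move=> y'; rewrite (perm_mem perm_p') -rot_c mem_rot.
Qed.

End LongestCycle.

Lemma nonempty_cycle : 1 < #|V| -> exists c, [/\ uniq c, cycle e c & 0 < size c].
Proof.
case/card_gt1P => x [y [_ _ nxy]].
have [z exz] : exists z, e x z.
  have [exy|nexy] := boolP (e x y); first by exists y.
  by have [z [exz _]] := two_step nxy nexy; exists z.
have nxz : x != z by apply: contraTneq exz => ->; rewrite e_irr.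
have [ezx|nezx] := boolP (e z x).
  by exists [:: x; z]; rewrite /= inE nxz exz ezx.
rewrite eq_sym in nxz; have [t [ezt etx]] := two_step nxz nezx.
exists [:: x; z; t]; rewrite /= !inE exz ezt etx; split=> //.
rewrite negb_or eq_sym nxz andbT /=; apply/andP; split.
  by apply: contraTneq etx => ->; rewrite e_irr.
by apply: contraTneq ezt => ->; rewrite e_irr.
Qed.

Theorem woodall_hamiltonian : 1 < #|V| ->
  exists c, [/\ uniq c, cycle e c & forall x, x \in c].
Proof.
case/nonempty_cycle => c0 [uniq_c0 cycle_c0 size_c0].
pose P n := [exists c : n.-tuple V, uniq c && cycle e c].
have PP c : uniq c -> cycle e c -> P (size c).
  by move=> uc cc; apply/existsP; exists (in_tuple c); rewrite /= uc cc.
have exP : exists n, P n by exists (size c0); apply: PP.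
have leP n : P n -> n <= #|V|.
  by case/existsP => c /andP[/card_uniqP size_c _]; rewrite -(size_tuple c) -size_c; apply: max_card.
case: (ex_maxnP exP leP) => n /existsP[c /andP[uniq_c cycle_c]] max_n.
have max_c c' : uniq c' -> cycle e c' -> size c' <= size c.
  by move=> uc' cc'; rewrite size_tuple; apply: max_n; apply: PP.
have gt0_c := leq_trans size_c0 (max_c c0 uniq_c0 cycle_c0).
have [v vc] : exists v, v \in tval c.
  by case: (tval c) gt0_c => // v s _; exists v; rewrite mem_head.
exists c; split=> // x; exact: longest_cycle_spanning vc.
Qed.

End Woodall.

(** * Merging each sink with the other source *)

Section Contraction.
Variables (V : finType) (e : rel V) (s1 s2 t1 t2 : V).
Hypothesis e_irr : irreflexive e.
Hypothesis uniq_ends : uniq [:: s1; s2; t1; t2].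

(* The merged vertices are represented by their sources: [s1] stands for the
   pair (t2, s1) and [s2] for (t1, s2), so arcs into them are arcs into
   [tau s1] and [tau s2]. *)
Let W := {x : V | x \notin [:: t1; t2]}.
Let tau x := if x == s1 then t2 else if x == s2 then t1 else x.
Let eW : rel W := fun x y => (x != y) && e (val x) (tau (val y)).

Lemma card_setD1_triple (a b c x : V) : x \in [set a; b; c] -> #|[set a; b; c] :\ x| <= 2.
Proof.
move=> xA; have : #|[set a; b; c]| <= 3.
  by rewrite -setUA cardsU1 cards2; case: (_ \notin _); case: (_ != _).
by rewrite (cardsD1 x) xA.
Qed.

(** The out-neighbours lost are the two sources and, for a merged vertex, the
    sink merged into it (whose arc becomes a loop); a source is not its own
    out-neighbour, so at most two are lost in every case. *)
Lemma outdeg_contraction x : outdeg e (val x) <= outdeg eW x + 2.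
Proof.
pose E := [set s1; s2; tau (val x)] :\ val x.
have leE : #|E| <= 2.
  by apply: card_setD1_triple; rewrite !inE /tau; do 2!case: eqP => //= _; rewrite eqxx ?orbT.
apply: leq_trans (leq_add (leqnn _) leE).
apply: leq_trans (leq_add (leq_imset_card (tau \o val) _) (leqnn _)).
apply: leq_trans (leq_card_setU _ _); apply/subset_leq_card/subsetP => w.
rewrite inE => exw; have nwx : w != val x by apply: contraTneq exw => ->; rewrite e_irr.
have [wE|nwE] := boolP (w \in E); first by rewrite inE wE orbT.
rewrite inE (negPf nwE) orbF; move: nwE; rewrite !inE nwx /= !negb_or.
case/andP=> /andP[nws1 nws2] nwx'.
pose z := if w == t2 then s1 else if w == t1 then s2 else w.
move: uniq_ends; rewrite /= !inE !negb_or -!andbA.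
case/and5P=> n12 ns1t1 ns1t2 ns2t1 /and3P[ns2t2 nt12 _].
have zW : z \notin [:: t1; t2].
  rewrite !inE /z; case: (eqVneq w t2) => [_|nwt2]; first by rewrite negb_or ns1t1.
  by case: (eqVneq w t1) => [_|nwt1]; rewrite negb_or ?ns2t1 // nwt1.
have tau_z : tau z = w.
  rewrite /tau /z; case: (eqVneq w t2) => [->|nwt2]; first by rewrite eqxx.
  case: (eqVneq w t1) => [->|nwt1]; first by rewrite eqxx eq_sym (negPf n12).
  by rewrite (negPf nws1) (negPf nws2).
apply/imsetP; exists (Sub z zW : W); last by rewrite /= tau_z.
rewrite inE /eW /= tau_z exw andbT; apply: contraNneq nwx' => ->.
by rewrite /= tau_z.
Qed.

Lemma indeg_contraction y : indeg e (tau (val y)) <= indeg eW y + 2.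
Proof.
pose E := [set t1; t2; val y] :\ tau (val y).
have leE : #|E| <= 2.
  by apply: card_setD1_triple; rewrite !inE /tau; case: ifP => _; [|case: ifP => _]; rewrite eqxx ?orbT.
apply: leq_trans (leq_add (leqnn _) leE).
apply: leq_trans (leq_add (leq_imset_card val _) (leqnn _)).
apply: leq_trans (leq_card_setU _ _); apply/subset_leq_card/subsetP => w.
rewrite inE => ewy; have nwy : w != tau (val y) by apply: contraTneq ewy => ->; rewrite e_irr.
have [wE|nwE] := boolP (w \in E); first by rewrite inE wE orbT.
rewrite inE (negPf nwE) orbF; move: nwE; rewrite !inE nwy /= negb_or.
case/andP=> nwt nwy'; have wW : w \notin [:: t1; t2] by rewrite !inE.
apply/imsetP; exists (Sub w wW : W) => //.
by rewrite inE /eW /= ewy andbT; apply: contraNneq nwy' => <-.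
Qed.

Lemma card_contraction : #|{: W}| + 2 = #|V|.
Proof.
rewrite card_sig -(cardC [in [:: t1; t2]]) addnC; congr (_ + _).
by apply/esym/card_uniqP; case/and3P: uniq_ends.
Qed.

(** Cut the cycle at the merged vertices: the arc that enters the vertex
    [s2] comes from an arc into [t1], and the arc back to [s1] from one into
    [t2]. *)
Lemma two_paths_of_cycle (c : seq W) :
  uniq c -> cycle eW c -> (forall x, x \in c) ->
  exists P1 P2, [/\ dipath e s1 t1 P1, dipath e s2 t2 P2, [disjoint P1 & P2]
                   & forall v, (v \in P1) || (v \in P2)].
Proof.
move=> uniq_c cycle_c full_c; move: (uniq_ends); rewrite /= !inE !negb_or -!andbA.
case/and5P=> n12 ns1t1 ns1t2 ns2t1 /and3P[ns2t2 nt12 _].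
have s1W : s1 \notin [:: t1; t2] by rewrite !inE negb_or ns1t1.
have s2W : s2 \notin [:: t1; t2] by rewrite !inE negb_or ns2t1.
pose w1 : W := Sub s1 s1W; pose w2 : W := Sub s2 s2W.
have [i r rot_c] := rot_to (full_c w1).
have : w2 \in w1 :: r by rewrite -rot_c mem_rot.
rewrite inE -val_eqE /= eq_sym (negPf n12) /= => w2r.
case/splitPr: r / w2r rot_c => p1 p2 rot_c.
pose P1 := s1 :: rcons (map val p1) t1; pose P2 := s2 :: rcons (map val p2) t2.
have perm_P : perm_eq (P1 ++ P2) [:: t1, t2 & map val (rot i c)].
  apply/permP => f; rewrite rot_c /P1 /P2 /= map_cat -!cats1 !count_cat /= !count_cat /=.
  move: (nat_of_bool (f s1)) (nat_of_bool (f s2)) (nat_of_bool (f t1)) (nat_of_bool (f t2)).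
  by move: (count f _) (count f _); clear; lia.
have uniq_P : uniq (P1 ++ P2).
  rewrite (perm_uniq perm_P) /= inE negb_or nt12 (map_inj_uniq val_inj) rot_uniq uniq_c.
  by rewrite andbT; apply/andP; split; apply/mapP => -[[x xW] _ /= def_t];
    move: xW; rewrite -def_t !inE eqxx ?orbT.
have uniq_r : uniq (w1 :: p1 ++ w2 :: p2) by rewrite -rot_c rot_uniq.
have lift_path x p : path eW x p -> w1 \notin p -> w2 \notin p ->
    path e (val x) (map val p).
  elim: p x => //= y p IH x /andP[/andP[_ exy] path_p].
  rewrite !inE !negb_or -!val_eqE /= => /andP[n1 w1p] /andP[n2 w2p].
  rewrite IH // andbT; move: exy.
  by rewrite /tau ![val y == _]eq_sym (negPf n1) (negPf n2).
move: cycle_c; rewrite -(rot_cycle i) rot_c /= rcons_cat cat_path /= rcons_path.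
case/and4P=> path1 /andP[_ arc1] path2 /andP[_ arc2].
move: uniq_r; rewrite cons_uniq mem_cat inE 2!negb_or cat_uniq /= negb_or.
case/and4P=> /and3P[w1p1 _ w1p2] _ /andP[w2p1 _] /andP[w2p2 _].
have := uniq_P; rewrite cat_uniq => /and3P[uniq1 disj uniq2].
exists P1, P2; split.
- rewrite /dipath /P1 last_rcons eqxx eqxx uniq1 rcons_path !andbT /=.
  rewrite (lift_path w1) // -[s1]/(val w1) last_map; move: arc1.
  by rewrite /tau /= eq_sym (negPf n12) eqxx.
- rewrite /dipath /P2 last_rcons eqxx eqxx uniq2 rcons_path !andbT /=.
  rewrite (lift_path w2) // -[s2]/(val w2) last_map; move: arc2.
  by rewrite /tau /= eqxx.
- by rewrite disjoint_sym disjoint_has.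
move=> v; rewrite -mem_cat (perm_mem perm_P) !inE orbA.
have [//|vW] := boolP ((v == t1) || (v == t2)).
have vW' : v \notin [:: t1; t2] by rewrite !inE.
by apply/mapP; exists (Sub v vW' : W); rewrite ?mem_rot.
Qed.

Lemma two_disjoint_paths :
  (forall x y, x != y -> ~~ e x y -> #|V| + 2 <= outdeg e x + indeg e y) ->
  exists P1 P2, [/\ dipath e s1 t1 P1, dipath e s2 t2 P2, [disjoint P1 & P2]
                   & forall v, (v \in P1) || (v \in P2)].
Proof.
move=> deg_e; have card_W := card_contraction.
have card_V : 4 <= #|V|.
  by have := max_card [in [:: s1; s2; t1; t2]]; rewrite (card_uniqP uniq_ends).
have eW_irr : irreflexive eW by move=> x; rewrite /eW eqxx.
have eW_deg x y : x != y -> ~~ eW x y -> #|{: W}| <= outdeg eW x + indeg eW y.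
  move=> nxy; rewrite /eW nxy /= => ne.
  have nx : val x != tau (val y).
    have := valP x; rewrite /= !inE negb_or => /andP[nx1 nx2].
    rewrite /tau; case: ifP => _; [exact: nx2|case: ifP => _; first exact: nx1].
    by rewrite val_eqE.
  have deg_xy := leq_trans (deg_e _ _ nx ne)
    (leq_add (outdeg_contraction x) (indeg_contraction y)).
  by move: deg_xy; rewrite -card_W addnACA -addnA leq_add2r.
have gt1_W : 1 < #|{: W}| by move: card_W card_V; clear; lia.
have [c [uniq_c cycle_c full_c]] := woodall_hamiltonian eW_irr eW_deg gt1_W.
exact: two_paths_of_cycle full_c.
Qed.

End Contraction.

Lemma paired2_coverable (V : finType) (e : rel V) :
  irreflexive e -> 4 <= #|V| ->
  (forall x y, x != y -> ~~ e x y -> #|V| + 2 <= outdeg e x + indeg e y) ->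
  paired_coverable 2 e.
Proof.
move=> e_irr card_V deg_e; split=> // s t inj_s inj_t nst.
have uniq_ends : uniq [:: s ord0; s ord_max; t ord0; t ord_max].
  by rewrite /= !inE !negb_or !nst !inj_eq.
have [P1 [P2 [path1 path2 disj cover]]] := two_disjoint_paths e_irr uniq_ends deg_e.
have ord2 (i : 'I_2) : i = ord0 \/ i = ord_max.
  by case: i => [[|[|//]] lti]; [left|right]; apply: val_inj.
exists (fun i => if i == ord0 then P1 else P2); split.
- by move=> i; case: (ord2 i) => ->.
- move=> i j; case: (ord2 i) => ->; case: (ord2 j) => ->; rewrite ?eqxx //= => _.
  by rewrite disjoint_sym.
- by move=> v; case/orP: (cover v) => vP; [exists ord0 | exists ord_max].
Qed.

(** * Sharpness *)

Section Sharpness.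
Variable m : nat.
Local Notation V := 'I_m.+4.+2.
Let v (i : nat) : V := inord i.
Let b := v 0.
Let z := v 1.

(** Vertex 0 is the sparsely connected vertex b, 1 the cut vertex z, 2 and 3 are the
    sources, 4 and 5 the sinks. *)
Definition hub_in : {set V} := [set v 1; v 4; v 5].
Definition hub_out : {set V} := [set v 1; v 2; v 3].

Definition sharp_arc : rel V := fun x y =>
  (x != y) && (if y == b then x \in hub_in else if x == b then y \in hub_out else true).

Lemma v_eq i j : i < 6 -> j < 6 -> (v i == v j) = (i == j).
Proof. by move=> lti ltj; rewrite -val_eqE /= !inordK //; lia. Qed.

Lemma sharp_deg x y : x != y -> ~~ sharp_arc x y ->
  outdeg sharp_arc x + indeg sharp_arc y = m + 7.
Proof.
have b_in : b \notin hub_in by rewrite !inE !v_eq.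
have b_out : b \notin hub_out by rewrite !inE !v_eq.
have card_in : #|hub_in| = 3 by rewrite /hub_in -setUA cardsU1 cards2 !inE !v_eq.
have card_out : #|hub_out| = 3 by rewrite /hub_out -setUA cardsU1 cards2 !inE !v_eq.
have card2 w : w != b -> #|~: [set w; b]| = m + 4.
  by move=> nwb; rewrite cardsCs setCK cards2 nwb card_ord; lia.
move=> nxy; rewrite {1}/sharp_arc nxy /=; case: (eqVneq y b) nxy => [->|nyb] nxy.
  move=> x_in.
  have -> : outdeg sharp_arc x = #|~: [set x; b]|.
    apply: eq_card => w; rewrite !inE /sharp_arc (negPf nxy) eq_sym negb_or.
    by case: (w == b); rewrite // (negPf x_in).
  have -> : indeg sharp_arc b = #|hub_in|.
    apply: eq_card => w; rewrite inE /sharp_arc eqxx.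
    by case: eqVneq => [->|]; rewrite // (negPf b_in).
  by rewrite card2 // card_in; lia.
case: (eqVneq x b) nxy => [->|//] nby y_out.
have -> : outdeg sharp_arc b = #|hub_out|.
  apply: eq_card => w; rewrite inE /sharp_arc eqxx.
  by case: (eqVneq w b) => [->|//]; rewrite (negPf b_out).
have -> : indeg sharp_arc y = #|~: [set y; b]|.
  apply: eq_card => w; rewrite !inE /sharp_arc (negPf nyb) negb_or.
  by case: (w == b); rewrite // (negPf y_out).
by rewrite card2 // card_out; lia.
Qed.

(** The path through b neither starts nor ends there, and the sources and
    sinks of the other path are not available; so z is both its predecessor and
    its successor. *)
Lemma sharp_not_coverable : ~ paired_coverable 2 sharp_arc.
Proof.
case=> _ cov; pose s (i : 'I_2) := v (2 + i); pose t (i : 'I_2) := v (4 + i).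
have lt2 (i : 'I_2) : 2 + i < 6 /\ 4 + i < 6 by have := ltn_ord i; lia.
have inj_s : injective s.
  move=> i j /eqP; have [li _] := lt2 i; have [lj _] := lt2 j.
  by rewrite v_eq // eqn_add2l => /eqP/val_inj.
have inj_t : injective t.
  move=> i j /eqP; have [_ li] := lt2 i; have [_ lj] := lt2 j.
  by rewrite v_eq // eqn_add2l => /eqP/val_inj.
have nst i j : s i != t j.
  by have [li _] := lt2 i; have [_ lj] := lt2 j; rewrite v_eq //; have := ltn_ord i; lia.
have [P [path_P disj cover]] := cov s t inj_s inj_t nst.
have end_s i : s i \in P i.
  by have := path_P i; rewrite /dipath; case: (P i) => // x q /and4P[/eqP-> _ _ _]; rewrite mem_head.
have end_t i : t i \in P i.
  by have := path_P i; rewrite /dipath; case: (P i) => // x q /and4P[_ _ /eqP<- _]; rewrite mem_last.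
have own_s i j : s j \in P i -> j = i.
  move=> sP; apply/eqP/negPn/negP => /disj; rewrite disjoint_has => /hasPn/(_ _ (end_s j)).
  by rewrite sP.
have own_t i j : t j \in P i -> j = i.
  move=> tP; apply/eqP/negPn/negP => /disj; rewrite disjoint_has => /hasPn/(_ _ (end_t j)).
  by rewrite tP.
have [i bP] := cover b.
have [ltsi ltti] := lt2 i.
have nbs : b != s i by rewrite v_eq.
have nbt : b != t i by rewrite v_eq.
have hub_s y : y \in hub_out -> y \in P i -> y != s i -> y = z.
  rewrite !inE -orbA => /or3P[/eqP-> //|/eqP->|/eqP->] yP.
    by have <- := own_s i ord0 yP; rewrite eqxx.
  by have <- := own_s i ord_max yP; rewrite eqxx.
have hub_t y : y \in hub_in -> y \in P i -> y != t i -> y = z.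
  rewrite !inE -orbA => /or3P[/eqP-> //|/eqP->|/eqP->] yP.
    by have <- := own_t i ord0 yP; rewrite eqxx.
  by have <- := own_t i ord_max yP; rewrite eqxx.
move: (path_P i) bP hub_s hub_t; rewrite /dipath; case: (P i) => // x q.
case/and4P=> /eqP-> path_q /eqP last_q uniq_q.
rewrite inE (negPf nbs) /= => b_q hub_s hub_t.
case/splitPr: q / b_q path_q last_q uniq_q hub_s hub_t => q1 q2.
rewrite -cat_cons cat_path last_cat => /and3P[_ arc_in path_q2] last_q.
rewrite cat_uniq => /and3P[_ /hasPn dis _] hub_s hub_t.
case: q2 => [|y q2] in path_q2 last_q dis hub_s hub_t *.
  by rewrite -last_q eqxx in nbt.
have l_q1 := mem_last (s i) q1; set l := last (s i) q1 in arc_in l_q1.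
have y_z : y = z.
  apply: hub_s.
  - case/andP: path_q2 => /andP[nby] + _; rewrite eqxx.
    by rewrite eq_sym (negPf nby).
  - by rewrite mem_cat !inE eqxx !orbT.
  - have : y \notin s i :: q1 by apply: dis; rewrite !inE eqxx orbT.
    by apply: contraNneq => ->; rewrite mem_head.
have l_z : l = z.
  apply: hub_t.
  - by case/andP: arc_in => _; rewrite eqxx.
  - by rewrite mem_cat l_q1.
  - apply: contraTneq l_q1 => ->; apply: dis.
    by rewrite -last_q /= inE mem_last orbT.
have : y \notin s i :: q1 by apply: dis; rewrite !inE eqxx orbT.
by rewrite y_z -l_z l_q1.
Qed.

End Sharpness.

Theorem theorem4 :
  (forall (V : finType) (e : rel V),
      irreflexive e ->
      4 <= #|V| ->
      (forall x y : V, x != y -> ~~ e x y ->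
         #|V| + 2 <= outdeg e x + indeg e y) ->
      paired_coverable 2 e) /\
  (forall n : nat, 9 <= n ->
      exists (V : finType) (e : rel V),
        [/\ irreflexive e,
            #|V| = n,
            forall x y : V, x != y -> ~~ e x y ->
              outdeg e x + indeg e y = n + 1
          & ~ paired_coverable 2 e]).
Proof.
split=> [V e e_irr card_V deg_e|n le9n]; first exact: paired2_coverable.
have [m def_n] : exists m, n = m + 6 by exists (n - 6); lia.
exists 'I_m.+4.+2, (@sharp_arc m); split.
- by move=> x; rewrite /sharp_arc eqxx.
- by rewrite card_ord; lia.
- by move=> x y nxy nexy; rewrite (sharp_deg nxy nexy) def_n -addnA.
- exact: sharp_not_coverable.
Qed.
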